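(* For every fixed integer $d\ge 2$ there exists $D_0(d)$ such that for all integers $D\ge D_0(d)$ the Kautz digraph $K(d,D)$ contains an edge $e$ whose shortest-path congestion satisfies \[ \mathrm{cong}(e)\;>\;\tau(d,D),\qquad\text{where } \tau(d,D)=(D-1)d^{D-2}+D\,d^{D-1}. \]
   Context: Write $[n]=\{0,1,\dots,n-1\}$. The Kautz digraph $K(d,D)$ has as vertices all words $x_0x_1\cdots x_{D-1}$ of length $D$ over the alphabet $[d+1]$ with $x_i\ne x_{i+1}$ for all $i$, and directed edges $x_0x_1\cdots x_{D-1}\to x_1\cdots x_{D-1}x_D$ for every $x_D\in[d+1]\setminus\{x_{D-1}\}$. Every ordered pair of distinct vertices is joined by a unique shortest directed path (its geodesic). For an edge $e$ of $K(d,D)$, $\mathrm{cong}(e)$ is the number of ordered pairs $(x,y)$ of distinct vertices whose unique geodesic from $x$ to $y$ uses $e$. *)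

(* Defs.v *)
From HB Require Import structures.
From mathcomp Require Import all_boot.
From mathcomp Require Import boolp.

Set Implicit Arguments.
Unset Strict Implicit.
Unset Printing Implicit Defensive.

(* A walk starting at x is represented, as in path.v, by the sequence p of its
   vertices after x; its length is size p. *)
Definition dwalk (T : finType) (r : rel T) (x y : T) (p : seq T) : Prop :=
  path r x p /\ last x p = y.

Definition geodesic (T : finType) (r : rel T) (x y : T) (p : seq T) : Prop :=
  dwalk r x y p /\ forall q : seq T, dwalk r x y q -> size p <= size q.

(* zip (x :: p) p lists the consecutive pairs of x :: p. *)
Definition uses_arc (T : finType) (x : T) (p : seq T) (e : T * T) : Prop :=
  e \in zip (x :: p) p.

(* Pairs with several geodesics would not be counted; Kautz digraphs have none. *)
Definition cong (T : finType) (r : rel T) (e : T * T) : nat :=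
  #|[set xy : T * T | (xy.1 != xy.2) &&
      `[< exists2 p : seq T, unique (geodesic r xy.1 xy.2) p
                           & uses_arc xy.1 p e >] ]|.

Definition kautz_word (d : nat) (w : seq 'I_d.+1) : bool :=
  sorted (fun a b => a != b) w.

Record kautz (d D : nat) : Type := Kautz {
  kautz_val :> D.-tuple 'I_d.+1;
  _ : kautz_word kautz_val
}.

HB.instance Definition _ (d D : nat) := [isSub for @kautz_val d D].
HB.instance Definition _ (d D : nat) := [Finite of kautz d D by <:].

(* There are no parallel arcs, since the appended letter is the last letter of
   y; so an arc can be identified with the pair of its endpoints. Testing the
   whole word rcons x a, rather than y alone, matters when D = 1. *)
Definition kautz_arc (d D : nat) : rel (kautz d D) := fun x y =>
  [exists a : 'I_d.+1, kautz_word (rcons x a) &&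
                       (y == behead (rcons x a) :> seq 'I_d.+1)].

(* The truncated subtractions are exact for 2 <= D. *)
Definition tau (d D : nat) : nat := (D - 1) * d ^ (D - 2) + D * d ^ (D - 1).

(* Main.v *)
Require Import Defs.
From mathcomp Require Import all_boot zify boolp.

Set Implicit Arguments.
Unset Strict Implicit.
Unset Printing Implicit Defensive.

(* A walk of length k in K(d,D) is a word of length D + k, and it passes through
   the arc e at step i iff the word of length D + 1 of e occurs at position i.
   There are d^(k-1) such words, and for k <= D the walk is the geodesic between
   its ends unless the word has a square centred at position k.  If no word were
   lost, the lengths k = D and k = D - 1 would contribute exactly tau and k = D - 2
   a surplus (D - 2) d^(D-3), so it is enough that the losses are o(D) d^D.

   Take for e a prefix of a ternary square-free word.  Then a square of half length
   p centred after a letters of e sticks out of e, say to the left, so p > a, and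
   a fraction d^(a-p) of the words is lost; moreover the first a letters of e occur
   in e again at position p, as far as e extends.  If a >= N, this means that p is an occurrence of
   the length-N prefix of e.  In a square-free word such occurrences are at
   least N apart, so there are about D/N of them, and each costs at most d^(k-1)
   after summing over a < p.  The at most 2N steps i with e less than N letters
   beyond the centre on one side cost at most d^(k-1) each. *)

(** * The Thue-Morse word and a square-free ternary word *)

Fixpoint tm_fuel (f n : nat) : bool :=
  if f is f'.+1 then odd n (+) tm_fuel f' n./2 else false.

(** Parity of the number of ones in the binary expansion of [n]; any fuel at least [n] gives the
    same value. *)
Definition thue_morse (n : nat) : bool := tm_fuel n n.

Lemma tm_fuelE f n : n <= f -> tm_fuel f n = thue_morse n.
Proof.
rewrite /thue_morse; elim/ltn_ind: n f => n IH [|f] le_nf; first by case: n le_nf {IH}.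
case: n => [|n] in le_nf IH *; first by elim: f {le_nf IH} => //= f ->.
by rewrite /= (IH n.+1./2) 1?(IH n.+1./2 _ n) //; lia.
Qed.

Lemma thue_morseE n : thue_morse n = odd n (+) thue_morse n./2.
Proof. by case: n => // n; rewrite {1}/thue_morse /= -(@tm_fuelE n) //; lia. Qed.

Lemma thue_morse_double n : thue_morse n.*2 = thue_morse n.
Proof. by rewrite thue_morseE odd_double doubleK. Qed.

Lemma thue_morse_doubleS n : thue_morse n.*2.+1 = ~~ thue_morse n.
Proof. by rewrite thue_morseE /= odd_double uphalf_double addTb. Qed.

Lemma thue_morse_eqS_odd n : thue_morse n = thue_morse n.+1 -> odd n.
Proof.
apply: contra_eqT => en; have := odd_double_half n; rewrite (negPf en) add0n => <-.
by rewrite thue_morse_double thue_morse_doubleS; case: thue_morse.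
Qed.

(** For [p] odd, equal neighbours at [i + j] would recur at distance [p], at a position of the other
    parity, against [thue_morse_eqS_odd]; so the letters alternate, and those at [i] and [i + p]
    differ. For [p] even, every second letter gives an overlap of period [p / 2], complemented when
    [i] is odd. *)
Lemma thue_morse_overlap_free p i : 0 < p ->
  ~ (forall j, j <= p -> thue_morse (i + j) = thue_morse (i + j + p)).
Proof.
elim/ltn_ind: p i => p IH i p0 ov; case: (boolP (odd p)) => [op|ep].
  have alt j : j < p -> thue_morse (i + j) <> thue_morse (i + j).+1.
    move=> jp E; have o1 := thue_morse_eqS_odd E.
    have := @thue_morse_eqS_odd (i + j + p).
    rewrite -(ov j (ltnW jp)) E -addnS (ov j.+1 jp) addnS addSn => /(_ erefl).
    by rewrite oddD o1 op.
  have key j : j <= p -> thue_morse (i + j) = odd j (+) thue_morse i.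
    elim: j => [|j IHj] jp; first by rewrite addn0.
    move: (alt j jp); rewrite IHj ?(ltnW jp) // addnS /=.
    by case: (odd j) (thue_morse i) (thue_morse (i + j).+1) => [] [] [].
  have := ov 0 isT; rewrite addn0 key // op; by case: thue_morse.
have [q pE] : exists q, p = q.*2 by exists p./2; lia.
have [h iE] : exists h, i = odd i + h.*2 by exists i./2; lia.
apply: (IH q _ h) => [||j jq]; [lia|lia|].
have := ov j.*2; rewrite iE pE; case: (odd i) => H; last first.
  rewrite -(thue_morse_double (h + j)) -(thue_morse_double (h + j + q)) !doubleD.
  by apply: H; rewrite leq_double.
apply: negb_inj; rewrite -!thue_morse_doubleS !doubleD.
by apply: H; rewrite leq_double.
Qed.

(** Codes the step from letter [n] of Thue-Morse to the next: 0 for no change, 1 for a rise, 2 for a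
    fall. *)
Definition vtm (n : nat) : nat :=
  if thue_morse n == thue_morse n.+1 then 0 else (thue_morse n).+1.

Lemma vtm_lt3 n : vtm n < 3.
Proof. by rewrite /vtm; case: ifP => // _; case: thue_morse. Qed.

(** Equal codes are equal steps, so the two Thue-Morse blocks of [p + 1] letters agree everywhere or
    nowhere. The first case is an overlap. In the second, complementary blocks with equal steps are
    constant, yet they share the letter at [i + p]. *)
Lemma vtm_squarefree i p : 0 < p -> ~ (forall j, j < p -> vtm (i + j) = vtm (i + j + p)).
Proof.
move=> p0 sq; pose c j := thue_morse (i + j) (+) thue_morse (i + j + p).
have cE j : j <= p -> c j = c 0.
  elim: j => // j IH jp; rewrite -IH; last by rewrite ltnW.
  move: (sq j jp); rewrite /vtm /c !addnS addSn.
  by do 4!case: thue_morse.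
case c0: (c 0); last first.
  apply: (@thue_morse_overlap_free p i p0) => j jp.
  by move: (cE j jp); rewrite c0 /c; do 2!case: thue_morse.
have zero j : j < p -> thue_morse (i + j) = thue_morse (i + j.+1).
  move=> jp; have := sq j jp; have := cE j (ltnW jp); have := cE j.+1 jp.
  by rewrite c0 /vtm /c addnS addSn; do 4!case: thue_morse.
have const j : j <= p -> thue_morse (i + j) = thue_morse (i + 0).
  by elim: j => // j IH jp; rewrite -zero // IH // ltnW.
by move: c0; rewrite /c -(const p) // addn0 addbb.
Qed.

(** * Extensions of a word and squares in them *)

Section Words.
Variable d : nat.
Implicit Types (h : 'I_d.+1) (e w : seq 'I_d.+1) (L R : seq 'I_d).

(* Letters that may follow x are coded by 'I_d through lift x. The filler L of
   extend is written from right to left, starting next to e. *)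
Definition fill h L : seq 'I_d.+1 := scanl (fun x c => lift x c) h L.

Definition extend L e R : seq 'I_d.+1 :=
  rev (fill (head ord0 e) L) ++ e ++ fill (last ord0 e) R.

Lemma size_fill h L : size (fill h L) = size L.
Proof. exact: size_scanl. Qed.

Lemma fill_inj h : injective (fill h).
Proof.
move=> L; elim: L h => [|c L IH] h [|c' L'] // eqcc.
have /lift_inj ec := congr1 (head h) eqcc; move: (congr1 behead eqcc).
by rewrite /= ec => /IH ->.
Qed.

Lemma take_fill t h L : take t (fill h L) = fill h (take t L).
Proof. by elim: L t h => [|c L IH] [|t] h //=; rewrite IH. Qed.

Lemma head_rev (T : Type) (x : T) s : head x (rev s) = last x s.
Proof. by elim/last_ind: s => // s y _; rewrite rev_rcons last_rcons. Qed.

Lemma size_extend L e R : size (extend L e R) = size L + size e + size R.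
Proof. by rewrite !size_cat size_rev !size_fill addnA. Qed.

Lemma rev_extend L e R : rev (extend L e R) = extend R (rev e) L.
Proof. by rewrite /extend !rev_cat revK head_rev -(head_rev _ (rev e)) revK catA. Qed.

Lemma path_fill h L : path (fun a b => a != b) h (fill h L).
Proof. by elim: L h => //= c L IH h; rewrite IH neq_lift. Qed.

Lemma kautz_extend L e R : e != [::] -> kautz_word e -> kautz_word (extend L e R).
Proof.
case: e => // x e _; rewrite /extend /kautz_word /= => ke.
have {ke} : path (fun a b => a != b) x (e ++ fill (last x e) R).
  by rewrite cat_path ke path_fill.
move: (_ ++ _) => s {e R}; elim: L x s => //= c L IH x s ks.
rewrite rev_cons cat_rcons; apply: IH => /=.
by rewrite ks andbT eq_sym neq_lift.
Qed.

(** The centre lies between positions [c - 1] and [c]; used with [p <= c], where [c - p] is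
    exact. *)
Definition square_at w c p : bool := 
  [forall j : 'I_p, nth ord0 w (c - p + j) == nth ord0 w (c + j)].

Lemma square_atP w c p :
  reflect (forall j, j < p -> nth ord0 w (c - p + j) = nth ord0 w (c + j))
          (square_at w c p).
Proof.
apply: (iffP forallP) => [H j jp|H j]; first by have /eqP := H (Ordinal jp).
by apply/eqP/H.
Qed.

Lemma square_at_rev w c c' p : size w = c + c' -> p <= c -> p <= c' ->
  square_at w c p -> square_at (rev w) c' p.
Proof.
move=> sw pc pc' /square_atP H; apply/square_atP => j jp.
rewrite !nth_rev ?sw; try lia.
have := H (p - j.+1) _.
have -> : c - p + (p - j.+1) = c + c' - (c' + j).+1 by lia.
have -> : c + (p - j.+1) = c + c' - (c' - p + j).+1 by lia.
by move=> <- //; lia.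
Qed.

Lemma nth_extend_mid m L e R j : size L = m -> j < size e ->
  nth ord0 (extend L e R) (m + j) = nth ord0 e j.
Proof.
by move=> <- je; rewrite nth_cat size_rev size_fill ltnNge leq_addr /= addKn nth_cat je.
Qed.

Lemma nth_extend_left L e R j : j < size L ->
  nth ord0 (extend L e R) (size L - j.+1) = nth ord0 (fill (head ord0 e) L) j.
Proof.
move=> jL; rewrite nth_cat size_rev size_fill ifT ?nth_rev ?size_fill; try lia.
by congr nth; lia.
Qed.

Lemma nth_extend_right L L' e R j : size L = size L' -> size L <= j ->
  nth ord0 (extend L e R) j = nth ord0 (extend L' e R) j.
Proof.
by move=> sL Lj; rewrite !(nth_cat _ (rev _)) !size_rev !size_fill -sL ltnNge Lj.
Qed.

(* The p - a letters of L next to e are forced by letters to the right of L. *)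
Lemma card_square_left e m n a p : a < p -> p <= m + a ->
  #|[set LR : m.-tuple 'I_d * n.-tuple 'I_d |
      square_at (extend LR.1 e LR.2) (m + a) p]| <= d ^ (m + n - (p - a)).
Proof.
move=> ap pma; set t := p - a.
pose f (LR : m.-tuple 'I_d * n.-tuple 'I_d) := ([tuple of drop t LR.1], LR.2).
have finj : {in [set LR : m.-tuple 'I_d * n.-tuple 'I_d |
      square_at (extend LR.1 e LR.2) (m + a) p] &, injective f}.
  move=> [L R] [L' R']; rewrite !inE /= => /square_atP s1 /square_atP s2.
  move=> [eD eR]; subst R'; congr pair; apply: val_inj => /=.
  rewrite -(cat_take_drop t L) -(cat_take_drop t L') eD; congr cat.
  apply: (@fill_inj (head ord0 e)); rewrite -!take_fill.
  have tm : t <= m by lia.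
  apply: (@eq_from_nth _ ord0); rewrite !size_takel ?size_fill ?size_tuple // => j jt.
  rewrite !nth_take // -!(nth_extend_left e R) ?size_tuple; try lia.
  have -> : m - j.+1 = m + a - p + (t - j.+1) by lia.
  rewrite s1 ?s2; try lia.
  by apply: nth_extend_right; rewrite !size_tuple //; lia.
rewrite -(card_in_imset finj); apply: leq_trans (max_card _) _.
by rewrite card_prod !card_tuple card_ord -expnD; apply/eq_leq; congr expn; lia.
Qed.

(** Reversal swaps the fillers and reduces this to the left case, with [size e - a] letters before
    the centre. *)
Lemma card_square_right e m n a p : a <= size e -> size e - a < p ->
  p <= m + a -> p <= n + (size e - a) ->
  #|[set LR : m.-tuple 'I_d * n.-tuple 'I_d |
      square_at (extend LR.1 e LR.2) (m + a) p]| <= d ^ (m + n - (p - (size e - a))).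
Proof.
move=> ae bp pma pnb; rewrite (addnC m n).
apply: leq_trans (card_square_left (rev e) m bp pnb).
pose f (LR : m.-tuple 'I_d * n.-tuple 'I_d) := (LR.2, LR.1).
have finj : injective f by move=> [? ?] [? ?] [-> ->].
rewrite -(card_imset _ finj); apply/subset_leq_card/subsetP => _ /imsetP[[L R] + ->].
rewrite !inE /= -rev_extend; apply: square_at_rev => //.
rewrite size_extend !size_tuple; lia.
Qed.

(** * Square-free words and occurrences of their prefixes *)

Definition squarefree w : Prop :=
  forall s p, 0 < p -> s + p + p <= size w ->
    ~ (forall j, j < p -> nth ord0 w (s + j) = nth ord0 w (s + p + j)).

Lemma squarefree_rev w : squarefree w -> squarefree (rev w).
Proof.
move=> sf s p p0 le H; rewrite size_rev in le.
apply: (sf (size w - (s + p + p)) p p0); first lia.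
move=> j jp; have := H (p - j.+1) _; rewrite !nth_rev; try lia.
have -> : size w - (s + (p - j.+1)).+1 = size w - (s + p + p) + p + j by lia.
have -> : size w - (s + p + (p - j.+1)).+1 = size w - (s + p + p) + j by lia.
by move=> -> //; lia.
Qed.

(* Occurrences of the length-N prefix of w, where those overlapping the right
   end of w only need to agree as far as w goes. *)
Definition occ n w N : {set 'I_n} :=
  [set p : 'I_n | [forall j : 'I_N,
     (p + j < size w) ==> (nth ord0 w j == nth ord0 w (p + j))]].

(** The left half covers the [a] letters from the start of [w] to the centre, and the right half
    repeats them [p] places later. Beyond the end of [w] the copy lies in the filler, hence the
    truncated test in [occ]. *)
Lemma occ_square l w N m n a (p : 'I_l) (L : m.-tuple 'I_d) (R : n.-tuple 'I_d) :
  N <= a -> a <= p -> p <= m + a ->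
  square_at (extend L w R) (m + a) p -> p \in occ l w N.
Proof.
move=> Na ap pma /square_atP H; rewrite inE; apply/forallP => j; apply/implyP => /= pj.
have jN := ltn_ord j.
have := H (p - a + j) _.
have -> : m + a - p + (p - a + j) = m + j by lia.
have -> : m + a + (p - a + j) = m + (p + j) by lia.
rewrite !nth_extend_mid ?size_tuple //; try lia.
by move=> -> //; lia.
Qed.

Lemma card_sparse_leq n N (P : {set 'I_n}) : 0 < N ->
  {in P &, forall p q : 'I_n, p < q -> p + N <= q} -> #|P| <= (n %/ N).+1.
Proof.
move=> N0 gap; pose f (p : 'I_n) : 'I_((n %/ N).+1) := inord (p %/ N).
have fE p : f p = p %/ N :> nat.
  by rewrite inordK // ltnS leq_div2r // ltnW.
have finj : {in P &, injective f}.
  move=> p q pP qP /(congr1 val) /=; rewrite !fE => E; apply: val_inj => /=.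
  have lt r s : r \in P -> s \in P -> r < s -> r %/ N < s %/ N.
    move=> rP sP /(gap r s rP sP) /(leq_div2r N).
    by rewrite divnDr // divnn N0 addn1.
  by case: (ltngtP p q) => // [/(lt p q pP qP)|/(lt q p qP pP)]; rewrite E ltnn.
by rewrite -(card_in_imset finj); apply: leq_trans (max_card _) _; rewrite card_ord.
Qed.

(** Two full occurrences at distance less than [N] begin with the same letters, so the stretch
    between their starts is repeated at once: a square. Fewer than [N] positions leave no room for a
    full occurrence, and these are all counted. *)
Lemma card_occ w N : 0 < N -> squarefree w ->
  #|occ (size w) w N| <= (size w %/ N).+1 + N.
Proof.
move=> N0 sf; pose T := [set p : 'I_(size w) | p + N <= size w].
rewrite -(cardsID T); apply: leq_add.
  apply: card_sparse_leq => // p q; rewrite !inE.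
  move=> /andP[/forallP op Tp] /andP[/forallP oq Tq] pq.
  rewrite leqNgt; apply/negP => qN.
  apply: (sf p (q - p)); [lia|lia|move=> j jqp].
  have jN : j < N by lia.
  have /implyP/(_ _)/eqP <- := op (Ordinal jN); last by rewrite /=; lia.
  have -> : p + (q - p) = q by lia.
  by apply/eqP; have /implyP := oq (Ordinal jN); apply; rewrite /=; lia.
apply: leq_trans (subset_leq_card (subsetDr _ _)) _.
(* On the complement of [T], [size w - p.+1] is already below [N]; the remainder only supplies the
   ordinal bound. *)
pose f (p : 'I_(size w)) : 'I_N := Ordinal (ltn_pmod (size w - p.+1) N0).
have finj : {in ~: T &, injective f}.
  move=> p q; rewrite !inE -!ltnNge => pN qN /(congr1 val) /=.
  have := ltn_ord p; have := ltn_ord q.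
  move=> ? ?; rewrite !modn_small; try lia.
  by move=> E; apply: val_inj => /=; lia.
by rewrite -(card_in_imset finj); apply: leq_trans (max_card _) _; rewrite card_ord.
Qed.

(** * Counting the lost words *)

Lemma card_leq_inj (I : finType) (P : pred I) (f : I -> nat) m :
  {in P &, injective f} -> (forall i, P i -> f i < m) -> #|P| <= m.
Proof.
move=> finj fm; rewrite cardE -(size_map f) -(size_iota 0 m).
apply: uniq_leq_size; last first.
  by move=> _ /mapP[i + ->]; rewrite mem_enum mem_iota => /fm ->.
rewrite map_inj_in_uniq ?enum_uniq // => i j; rewrite !mem_enum; exact: finj.
Qed.

(** At worst the exponents are all of 0, ..., m - 1, and for [d >= 2] this geometric sum is at most
    [d ^ m]. *)
Lemma sum_expn_inj (I : finType) (P : pred I) (f : I -> nat) m : 1 < d ->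
  {in P &, injective f} -> (forall i, P i -> f i < m) ->
  \sum_(i | P i) d ^ f i <= d ^ m.
Proof.
move=> d1; elim: m P => [|m IH] P finj fm.
  by rewrite big_pred0 // => i; apply/negP => /fm.
rewrite (bigID (fun i => f i == m)) /=; apply: (@leq_trans (d ^ m + d ^ m)); last first.
  by rewrite addnn -mul2n expnS leq_mul2r d1 orbT.
apply: leq_add; last first.
  apply: (IH (fun i => P i && (f i != m))) => [i j /andP[Pi _] /andP[Pj _]|i /andP[Pi]]; first exact: finj.
  by have := fm i Pi; lia.
case: (pickP (fun i => P i && (f i == m))) => [i /andP[Pi /eqP fi]|none]; last by rewrite big_pred0.
rewrite (big_pred1 i) ?fi // => j; apply/andP/eqP => [[Pj /eqP fj]|->]; last by rewrite fi.
by apply: finj; rewrite // fi fj.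
Qed.

Lemma card_bigcup_leq (I T : finType) (P : pred I) (F : I -> {set T}) :
  #|\bigcup_(i | P i) F i| <= \sum_(i | P i) #|F i|.
Proof.
elim/big_rec2: _ => [|i m A _ le]; first by rewrite cards0.
by rewrite cardsU; apply: leq_trans (leq_subr _ _) _; rewrite leq_add2l.
Qed.

(** Fillers discarded for walks of length [k] that use the arc of [e] at step [i]: without a square
    at [k] the walk is a geodesic. The range of [p] suffices for [k <= D]. *)
Definition bad D e k i : {set i.-tuple 'I_d * (k.-1 - i).-tuple 'I_d} :=
  [set LR : i.-tuple 'I_d * (k.-1 - i).-tuple 'I_d |
    [exists p : 'I_D.+1, (0 < p <= k) && square_at (extend LR.1 e LR.2) k p]].

Lemma card_fillers k i : i < k ->
  #|{: i.-tuple 'I_d * (k.-1 - i).-tuple 'I_d}| = d ^ k.-1.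
Proof.
by move=> ik; rewrite card_prod !card_tuple card_ord -expnD subnKC //; lia.
Qed.

Section Bad.
Variables (D N : nat) (e : seq 'I_d.+1).
Hypotheses (size_e : size e = D.+1) (sf_e : squarefree e) (N0 : 0 < N) (d1 : 1 < d).

Lemma card_bad_at k i : i < k -> k <= D ->
  #|bad D e k i| <= ((k - i < N) + (D.+1 + i - k < N)) * d ^ k.-1
   + (\sum_(p in occ D.+1 e N | k - i < p <= k) d ^ (k.-1 - (p - (k - i)))
   + \sum_(p in occ D.+1 (rev e) N | D.+1 + i - k < p <= k)
        d ^ (k.-1 - (p - (D.+1 + i - k)))).
Proof.
(* [a] and [b] count the letters of [e] before and after the centre [k]. *)
move=> ik kD; set a := k - i; set b := D.+1 + i - k.
have triv : #|bad D e k i| <= d ^ k.-1 by rewrite -(card_fillers ik) max_card.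
case: ltnP => [aN|Na].
  by apply: leq_trans (leq_addr _ _); apply: leq_trans triv _; rewrite leq_pmull.
case: ltnP => [bN|Nb].
  by apply: leq_trans (leq_addr _ _); apply: leq_trans triv _; rewrite leq_pmull.
rewrite mul0n add0n.
pose S (p : nat) := [set LR : i.-tuple 'I_d * (k.-1 - i).-tuple 'I_d |
  square_at (extend LR.1 e LR.2) k p].
have sub : bad D e k i \subset \bigcup_(p : 'I_D.+1 | 0 < p <= k) S p.
  apply/subsetP => LR; rewrite inE => /existsP[p /andP[pk sq]].
  by apply/bigcupP; exists p => //; rewrite inE.
apply: leq_trans (subset_leq_card sub) _; apply: leq_trans (card_bigcup_leq _ _) _.
rewrite !(big_mkcond (fun p => _ && _)) /= -big_split /=.
apply: leq_sum => p _; case: andP => // -[p0 pk]; rewrite !pk !andbT.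
have [ka kb] : i + a = k /\ k.-1 - i + b = D by lia.
have sab : size e - a = b by lia.
have [S0|[[L R]]] := set_0Vmem (S p); first by rewrite S0 cards0.
rewrite inE /= => sqk.
have sq : square_at (extend L e R) (i + a) p by rewrite ka.
case: (ltnP a p) => [ap|pa].
  rewrite (occ_square Na (ltnW ap) _ sq) ?ka //=.
  apply: leq_trans (leq_addr _ _).
  have := @card_square_left e i (k.-1 - i) a p ap; rewrite ka => /(_ pk).
  by congr (_ <= d ^ _); lia.
case: (ltnP b p) => [bp|pb].
  (* The square sticks out on the right, hence on the left after reversal. *)
  have sqr : square_at (extend R (rev e) L) (k.-1 - i + b) p.
    rewrite -rev_extend; apply: square_at_rev sq; rewrite ?size_extend ?size_tuple; lia.
  rewrite (occ_square Nb (ltnW bp) _ sqr) /=; last by lia.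
  apply: leq_trans (leq_addl _ _).
  have := @card_square_right e i (k.-1 - i) a p; rewrite sab ka => H.
  apply: leq_trans (H _ bp pk _) _; try lia.
  by apply/eq_leq; congr expn; lia.
(* With [p <= a] and [p <= b] the whole square lies inside [e]. *)
case: (sf_e (s := a - p) (p := p)) => //; first by lia.
move=> j jp; move/square_atP: sq => /(_ j jp).
have -> : i + a - p + j = i + (a - p + j) by lia.
rewrite -addnA !nth_extend_mid ?size_tuple //; try lia.
by move=> ->; congr nth; lia.
Qed.

Lemma sum_card_bad k : k <= D ->
  \sum_(i < k) #|bad D e k i| <= (2 * N + 2 * ((D.+1 %/ N).+1 + N)) * d ^ k.-1.
Proof.
move=> kD; apply: leq_trans.
  by apply: leq_sum => i _; apply: card_bad_at (ltn_ord i) kD.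
rewrite !big_split /= -big_distrl /= big_split /=.
have card_lt (f : 'I_k -> nat) : injective f -> \sum_i (f i < N) <= N.
  move=> finj; rewrite (_ : \sum_i _ = #|[pred i | f i < N]|); last first.
    by rewrite -sum1_card [RHS]big_mkcond; apply: eq_bigr => i _; rewrite inE; case: ltnP.
  by apply: (card_leq_inj (f := f)) => // i j _ _; apply: finj.
have sum_occ (P : {set 'I_D.+1}) (c : 'I_k -> nat) :
    injective c -> (forall i, 0 < c i) ->
    \sum_i \sum_(p in P | c i < p <= k) d ^ (k.-1 - (p - c i)) <= #|P| * d ^ k.-1.
  (* For fixed [p] the exponents are distinct as [i] varies: [0 < c i] and [p <= k] keep the
     subtraction exact. *)
  move=> cinj c0; rewrite (exchange_big_dep (mem P)) /= => [|i p _ /andP[]] //.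
  rewrite -sum_nat_const; apply: leq_sum => p ->.
  apply: sum_expn_inj => // [i j /andP[? ?] /andP[? ?] E|i /andP[? ?]].
    by apply: cinj; have := c0 i; have := c0 j; lia.
  by have := c0 i; lia.
rewrite [X in _ <= X]mulnDl; apply: leq_add.
  rewrite leq_mul2r mul2n -addnn; apply/orP; right; apply: leq_add.
    by apply: card_lt => i j E; apply: val_inj; have := ltn_ord i; have := ltn_ord j; rewrite /=; lia.
  by apply: card_lt => i j E; apply: val_inj; rewrite /=; lia.
rewrite mul2n -addnn mulnDl; apply: leq_add.
  apply: leq_trans (sum_occ _ _ _ _) _ => [i j E|i|].
  - by apply: val_inj; have := ltn_ord i; have := ltn_ord j; rewrite /=; lia.
  - by have := ltn_ord i; lia.
  - by rewrite leq_mul2r -size_e card_occ // orbT.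
apply: leq_trans (sum_occ _ _ _ _) _ => [i j E|i|].
- by apply: val_inj; rewrite /=; lia.
- by lia.
- by rewrite leq_mul2r -size_e -(size_rev e) card_occ ?orbT //; apply: squarefree_rev.
Qed.
End Bad.
End Words.

(** * Walks of the Kautz digraph as words *)

Section Graph.
Variables (d D : nat) (x0 : kautz d D).
Hypothesis D0 : 0 < D.
Implicit Types (w c : seq 'I_d.+1) (x y : kautz d D) (p : seq (kautz d D)).

Notation arc := (@kautz_arc d D).

(** Total, with default [x0], so that vertices can be named by words without carrying proofs. *)
Definition mk w : kautz d D := insubd x0 (insubd (kautz_val x0) w).

Lemma mkK w : size w = D -> kautz_word w -> mk w = w :> seq _.
Proof.
move=> sw kw; have E : insubd (kautz_val x0) w = w :> seq _.
  by rewrite val_insubd sw eqxx.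
rewrite -[RHS]E; congr (tval _); apply: insubdK.
by rewrite unfold_in /= E.
Qed.

Lemma kautz_seq_inj x y : x = y :> seq _ -> x = y.
Proof. by move=> E; apply: val_inj; apply: val_inj. Qed.

Lemma kautz_wordP x : kautz_word x.
Proof. by case: x. Qed.

Definition vertex w j := mk (take D (drop j w)).

Lemma val_vertex w k j : size w = D + k -> kautz_word w -> j <= k ->
  vertex w j = take D (drop j w) :> seq _.
Proof.
move=> sw kw jk; rewrite /vertex mkK //; last exact/take_sorted/drop_sorted.
by rewrite size_takel // size_drop; lia.
Qed.

Definition walk_of w k := [seq vertex w j | j <- iota 1 k].

Lemma nth_walk_of w k i : i < k -> nth x0 (walk_of w k) i = vertex w i.+1.
Proof. by move=> ik; rewrite (nth_map 0) ?size_iota // nth_iota. Qed.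

Lemma nth_cons_walk_of w k i : i <= k ->
  nth x0 (vertex w 0 :: walk_of w k) i = vertex w i.
Proof. by case: i => // i ik; rewrite /= nth_walk_of. Qed.

Lemma arc_vertex w k j : size w = D + k -> kautz_word w -> j < k ->
  arc (vertex w j) (vertex w j.+1).
Proof.
move=> sw kw jk; apply/existsP; exists (nth ord0 w (j + D)).
rewrite !(val_vertex sw kw) ?(ltnW jk) // -nth_drop -take_nth; last by rewrite size_drop; lia.
have -> : behead (take D.+1 (drop j w)) = take D (drop j.+1 w).
  by rewrite -[j.+1]add1n -drop_drop drop1; case: (drop j w).
by rewrite eqxx andbT; apply/take_sorted/drop_sorted.
Qed.

Lemma dwalk_walk_of w k : size w = D + k -> kautz_word w ->
  dwalk arc (vertex w 0) (vertex w k) (walk_of w k).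
Proof.
move=> sw kw; split; last first.
  by rewrite (last_nth x0) size_map size_iota nth_cons_walk_of.
apply/(pathP x0) => i; rewrite size_map size_iota => ik.
by rewrite nth_cons_walk_of ?(ltnW ik) // nth_walk_of //; apply: arc_vertex sw kw ik.
Qed.

(** An arc drops the first letter, so prepending the first letter of [x] to the word of the
    remaining walk gives the word of the whole walk. *)
Lemma word_of_dwalk x y p : dwalk arc x y p ->
  exists w, [/\ size w = D + size p, kautz_word w, take D w = x,
                drop (size p) w = y & p = walk_of w (size p)].
Proof.
rewrite /dwalk; elim: p x => [|z p IH] x [pa lE].
  by exists x; rewrite -lE drop0 take_oversize ?size_tuple ?addn0 ?kautz_wordP //=.
case/andP: pa => /existsP[a /andP[ka /eqP zE]] pa.
have [w [sw kw tw dw pE]] := IH z (conj pa lE).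
have xE : x = head ord0 x :: behead x :> seq _ by case: (tval x) (size_tuple x) D0 => //= <-.
have bE : behead (rcons x a) = rcons (behead x) a by rewrite xE.
set w' := head ord0 x :: w.
have w'E : w' = rcons x a ++ drop D w by rewrite /w' xE /= -bE -zE -tw cat_take_drop.
have sw' : size w' = D + (size p).+1 by rewrite /= sw addnS.
have kw' : kautz_word w'.
  rewrite /w' /kautz_word /=; case: w sw kw tw {dw pE w' w'E sw'} => [|b w] //= _ kw tw.
  have hb : b = head ord0 (rcons (behead x) a) by rewrite -bE -zE -tw -(prednK D0).
  rewrite kw andbT; move: ka; rewrite xE hb /kautz_word /=.
  by case: (behead x) => [|? ?] /= /andP[].
exists w'; split=> //.
- by rewrite w'E take_cat size_rcons size_tuple leqnn -cats1 take_cat size_tuple ltnn subnn take0 cats0.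
- rewrite /walk_of /= {1}pE /vertex /= drop0; congr cons.
    by apply: kautz_seq_inj; rewrite -tw mkK // ?size_takel ?sw ?leq_addr //; apply: take_sorted.
  by rewrite /walk_of -(addn1 1) iotaDl -map_comp; apply: eq_map.
Qed.

(* If the ends of w are also joined by a word w' shorter by p = k - k', reading
   the common middle part in both ways gives a period p around position k. *)
Lemma shortcut_square w w' k k' : size w = D + k -> size w' = D + k' -> k' < k -> k <= D ->
  take D w = take D w' -> drop k w = drop k' w' -> square_at w k (k - k').
Proof.
move=> sw sw' k'k kD tE dE; apply/square_atP => j jk.
rewrite -[RHS]nth_drop dE nth_drop.
have -> : k - (k - k') + j = k' + j by lia.
have lt : k' + j < D by lia.
by rewrite -(nth_take ord0 lt w) tE nth_take.
Qed.

(** For [k <= D] the first [D] letters and those from position [k] on cover the word. *)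
Lemma word_of_ends w w' k : size w = D + k -> size w' = D + k -> k <= D ->
  take D w = take D w' -> drop k w = drop k w' -> w = w'.
Proof.
move=> sw sw' kD tE dE; rewrite -(cat_take_drop D w) -(cat_take_drop D w') tE.
by rewrite -(subnK kD) -!drop_drop dE.
Qed.

Definition no_square w k := forall p : nat, 0 < p -> p <= k -> ~~ square_at w k p.

Lemma drop_vertex w k : size w = D + k -> kautz_word w -> vertex w k = drop k w :> seq _.
Proof.
by move=> sw kw; rewrite (val_vertex sw) // take_oversize // size_drop sw; lia.
Qed.

(** A shorter walk between the ends would create a square at [k], and one of equal length spells the
    same word. *)
Lemma geodesic_walk_of w k : size w = D + k -> kautz_word w -> k <= D ->
  no_square w k -> unique (geodesic arc (vertex w 0) (vertex w k)) (walk_of w k).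
Proof.
move=> sw kw kD nsq.
have swalk : size (walk_of w k) = k by rewrite size_map size_iota.
have ends q : dwalk arc (vertex w 0) (vertex w k) q -> exists w', [/\ size w' = D + size q,
    take D w = take D w', drop k w = drop (size q) w' & q = walk_of w' (size q)].
  case/word_of_dwalk=> w' [sw' kw' tw' dw' qE]; exists w'; split=> //.
    by rewrite tw' (val_vertex sw) // drop0.
  by rewrite dw' drop_vertex.
have minw q : dwalk arc (vertex w 0) (vertex w k) q -> k <= size q.
  case/ends=> w' [sw' tE dE _]; rewrite leqNgt; apply/negP => qk.
  apply: (negP (nsq (k - size q) _ _)); [lia|lia|].
  exact: shortcut_square sw sw' qk kD tE dE.
have dw := dwalk_walk_of sw kw.
split; first by split=> // q /minw; rewrite swalk.
move=> q [dq /(_ _ dw)]; rewrite swalk => qk.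
have sq : size q = k by apply/eqP; rewrite eqn_leq qk minw.
have [w' [sw' tE dE ->]] := ends q dq; rewrite sq in sw' dE *.
by rewrite (word_of_ends sw sw').
Qed.

Lemma uses_arc_walk_of w k i : i < k ->
  uses_arc (vertex w 0) (walk_of w k) (vertex w i, vertex w i.+1).
Proof.
move=> ik; rewrite /uses_arc -(nth_walk_of w ik) -(nth_cons_walk_of w (ltnW ik)).
have s : size (zip (vertex w 0 :: walk_of w k) (walk_of w k)) = k.
  by rewrite size_zip /= size_map size_iota; apply/minn_idPr.
apply/(nthP (x0, x0)); exists i; rewrite ?s //.
by rewrite nth_zip_cond s ik.
Qed.

Lemma vertex_neq w k : size w = D + k -> kautz_word w -> 0 < k -> k <= D ->
  no_square w k -> vertex w 0 != vertex w k.
Proof.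
move=> sw kw k0 kD nsq; apply/eqP => /(congr1 (fun x => tval (kautz_val x))) /=.
rewrite (drop_vertex sw) // (val_vertex sw) // drop0 => E.
(* Equal ends are joined by the empty walk, with word [take D w]; this shortcut yields a square of
   half length [k]. *)
have /negP[] := nsq k k0 (leqnn k); rewrite -{2}(subn0 k).
by apply: (@shortcut_square w (take D w) k 0); rewrite ?drop0 ?take_takel ?addn0 // size_takel // sw leq_addr.
Qed.

(** * Pairs of vertices whose geodesic uses the arc of [e] *)

Section Family.
Variable e : seq 'I_d.+1.
Hypotheses (size_e : size e = D.+1) (kautz_e : kautz_word e).

Definition arc_of_word := (mk (take D e), mk (behead e)).

Definition through i j (LR : i.-tuple 'I_d * j.-tuple 'I_d) := extend LR.1 e LR.2.

Lemma size_through k i (LR : i.-tuple 'I_d * (k.-1 - i).-tuple 'I_d) :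
  i < k -> size (through LR) = D + k.
Proof. by move=> ik; rewrite size_extend size_e !size_tuple; lia. Qed.

Lemma kautz_through i j (LR : i.-tuple 'I_d * j.-tuple 'I_d) : kautz_word (through LR).
Proof. by apply: kautz_extend => //; rewrite -size_eq0 size_e. Qed.

Lemma take_drop_through i j (LR : i.-tuple 'I_d * j.-tuple 'I_d) :
  take D.+1 (drop i (through LR)) = e.
Proof.
rewrite drop_cat size_rev size_fill size_tuple ltnn subnn drop0.
by rewrite take_cat size_e ltnn subnn take0 cats0.
Qed.

Lemma arc_of_wordE i j (LR : i.-tuple 'I_d * j.-tuple 'I_d) :
  arc_of_word = (vertex (through LR) i, vertex (through LR) i.+1).
Proof.
rewrite /arc_of_word /vertex -{1 2}(take_drop_through LR) take_takel //; congr (_, mk _).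
by rewrite -[i.+1]add1n -drop_drop drop1; case: (drop i _).
Qed.

Lemma arc_of_wordP : kautz_arc arc_of_word.1 arc_of_word.2.
Proof.
(* With [k = 1] both fillers are empty and the extended word is [e] itself. *)
pose LR : 0.-tuple 'I_d * (1.-1 - 0).-tuple 'I_d := ([tuple], [tuple]).
by rewrite (arc_of_wordE LR); apply: (@arc_vertex _ 1); rewrite ?size_through ?kautz_through.
Qed.

Lemma notin_badP k i (LR : i.-tuple 'I_d * (k.-1 - i).-tuple 'I_d) : k <= D ->
  LR \notin bad D e k i -> no_square (through LR) k.
Proof.
move=> kD; rewrite inE => /existsPn H p p0 pk.
have pD : p < D.+1 by lia.
by have := H (Ordinal pD); rewrite /= p0 pk.
Qed.

Definition ends k i : {set kautz d D * kautz d D} :=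
  [set (vertex (through LR) 0, vertex (through LR) k) | LR in ~: bad D e k i].

Lemma ends_cong k i : i < k -> k <= D -> ends k i \subset
  [set xy : kautz d D * kautz d D | (xy.1 != xy.2) &&
      `[< exists2 p, unique (geodesic arc xy.1 xy.2) p & uses_arc xy.1 p arc_of_word >] ].
Proof.
move=> ik kD; apply/subsetP => _ /imsetP[LR + ->]; rewrite inE => /(notin_badP kD) nsq.
have sw := size_through LR ik; have kw := kautz_through LR.
rewrite inE /= (vertex_neq sw) //=; last by lia.
apply/asboolP; exists (walk_of (through LR) k); first exact: geodesic_walk_of.
by rewrite (arc_of_wordE LR); apply: uses_arc_walk_of.
Qed.

Lemma through_inj i j : injective (@through i j).
Proof.
move=> [L R] [L' R'] /= /eqP; rewrite /through /= /extend.
rewrite eqseq_cat ?size_rev ?size_fill ?size_tuple // => /andP[/eqP/(can_inj revK)/fill_inj eL].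
rewrite eqseq_cat // eqxx /= => /eqP/fill_inj eR.
by congr pair; apply: val_inj.
Qed.

(** If the lengths differed, the shorter walk would create a square in the longer word; words of
    equal length are determined by their ends. *)
Lemma vertices_inj w w' k k' : size w = D + k -> kautz_word w -> no_square w k -> k <= D ->
  size w' = D + k' -> kautz_word w' -> no_square w' k' -> k' <= D ->
  vertex w 0 = vertex w' 0 -> vertex w k = vertex w' k' -> k = k' /\ w = w'.
Proof.
move=> sw kw nw kD sw' kw' nw' kD' /(congr1 (fun x => tval (kautz_val x))) /=.
rewrite (val_vertex sw) // (val_vertex sw') // !drop0 => tE.
move/(congr1 (fun x => tval (kautz_val x))); rewrite /= (drop_vertex sw) // (drop_vertex sw') // => dE.
case: (ltngtP k k') => [lt|lt|E].
- have := nw' (k' - k); rewrite (shortcut_square sw' sw) //= => H.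
  by move: H; rewrite subn_gt0 lt leq_subr => /(_ isT isT).
- have := nw (k - k'); rewrite (shortcut_square sw sw') //= => H.
  by move: H; rewrite subn_gt0 lt leq_subr => /(_ isT isT).
by subst k'; rewrite (word_of_ends sw sw').
Qed.

Lemma card_ends k i : i < k -> k <= D -> #|ends k i| + #|bad D e k i| = d ^ k.-1.
Proof.
move=> ik kD; rewrite -(card_fillers d ik) -(cardsC (bad D e k i)) addnC; congr addn.
apply: card_in_imset => LR LR'; rewrite !inE => b1 b2 [E1 E2].
apply: through_inj; have sw := size_through LR ik; have sw' := size_through LR' ik.
by have [] := vertices_inj sw (kautz_through LR) (notin_badP kD _) kD sw'
  (kautz_through LR') (notin_badP kD _) kD E1 E2; rewrite ?inE.
Qed.

(** Makes sure that no pair is counted twice. A common pair forces the same [k] and the same word,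
    and a square-free centre lets [e] occur only once at a position below [k]. *)
Lemma disjoint_ends k i k' i' : i < k -> k <= D -> i' < k' -> k' <= D ->
  (k, i) != (k', i') -> [disjoint ends k i & ends k' i'].
Proof.
move=> ik kD ik' kD'; apply: contraR => /pred0Pn[xy /andP[/imsetP[LR b1 ->]]].
move=> /imsetP[LR' b2 [E1 E2]]; rewrite !inE in b1 b2.
have sw := size_through LR ik; have sw' := size_through LR' ik'.
have n1 : no_square (through LR) k by apply: notin_badP; rewrite ?inE.
have n2 : no_square (through LR') k' by apply: notin_badP; rewrite ?inE.
have [kE wE] := vertices_inj sw (kautz_through LR) n1 kD sw' (kautz_through LR') n2 kD' E1 E2.
rewrite -kE in ik' *; apply/eqP; congr pair; move: n1 (take_drop_through LR).
(* Both copies of e cover the centre k, so their distance is a period around k. *)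
have key j j' (u : seq 'I_d.+1) : j < j' -> j' < k -> no_square u k ->
    take D.+1 (drop j u) = e -> take D.+1 (drop j' u) = e -> False.
  move=> jj jk nu e1 e2; have /negP[] : ~~ square_at u k (j' - j) by apply: nu; lia.
  apply/square_atP => m mj.
  have h1 : k - j' + m < D.+1 by lia.
  have -> : k - (j' - j) + m = j + (k - j' + m) by lia.
  have -> : k + m = j' + (k - j' + m) by lia.
  by move: (congr1 (nth ord0 ^~ (k - j' + m)) (etrans e1 (esym e2))); rewrite /= !nth_take // !nth_drop.
move=> n1 e1; have e2 := take_drop_through LR'; rewrite -wE in e2.
by case: (ltngtP i i') => // lt; [case: (key i i' (through LR))|case: (key i' i (through LR))].
Qed.

Lemma sum_card_ends : \sum_(k < D.+1) \sum_(i < k) #|ends k i| <= cong arc arc_of_word.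
Proof.
pose P (ki : 'I_D.+1 * 'I_D) := ki.2 < ki.1.
have -> : \sum_(k < D.+1) \sum_(i < k) #|ends k i| = \sum_(ki | P ki) #|ends ki.1 ki.2|.
  rewrite -(pair_big_dep xpredT (fun (k : 'I_D.+1) (i : 'I_D) => i < k)
             (fun k i => #|ends k i|)) /=.
  by apply: eq_bigr => k _; rewrite (big_ord_widen D (fun i => #|ends k i|)) // -ltnS.
pose F (ki : 'I_D.+1 * 'I_D) := if P ki then ends ki.1 ki.2 else set0.
have -> : \sum_(ki | P ki) #|ends ki.1 ki.2| = \sum_ki \sum_(x in F ki) 1.
  by rewrite big_mkcond; apply: eq_bigr => ki _; rewrite sum1_card /F; case: ifP; rewrite ?cards0.
rewrite -partition_disjoint_bigcup; last first.
  move=> [k i] [k' i'] ne; rewrite /F /P /=.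
  case: ifP => ik; last by rewrite disjoints_subset sub0set.
  case: ifP => ik'; last by rewrite disjoint_sym disjoints_subset sub0set.
  by apply: disjoint_ends => //; rewrite -ltnS.
rewrite sum1_card; apply/subset_leq_card/bigcupsP => -[k i] _; rewrite /F /P /=.
by case: ifP => ik; rewrite ?sub0set // ends_cong // -ltnS.
Qed.

End Family.
End Graph.

(** * Choice of the word and the final estimate *)

Definition vtm_prefix d n : seq 'I_d.+1 := mkseq (fun j => inord (vtm j)) n.

Lemma vtm_prefix_squarefree d n : 1 < d -> squarefree (vtm_prefix d n).
Proof.
move=> d1 s p p0; rewrite size_mkseq => le H; apply: (@vtm_squarefree s p p0) => j jp.
have := H j jp; rewrite !nth_mkseq; try lia.
have lt i : vtm i < d.+1 by have := vtm_lt3 i; lia.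
by move=> /(congr1 val); rewrite /= !inordK // addnAC.
Qed.

Lemma squarefree_kautz d (w : seq 'I_d.+1) : squarefree w -> kautz_word w.
Proof.
move=> sf; apply/(sortedP ord0) => i iw; apply/eqP => E.
apply: (sf i 1) => //; first by lia.
by case=> // _; rewrite !addn0 addn1.
Qed.

(** Keeps only the lengths [D], [D - 1] and [D - 2]. Their main terms [k * d ^ k.-1] add up to the
    left-hand side, and the factor [d ^ 2 + d + 1] collects their three losses. *)
Lemma cong_tau_bound d D x0 (e : seq 'I_d.+1) (N : nat) : 1 < d -> 2 < D -> 0 < N ->
  size e = D.+1 -> squarefree e ->
  tau d D + (D - 2) * d ^ (D - 3) <= cong (@kautz_arc d D) (arc_of_word x0 e)
    + (2 * N + 2 * ((D.+1 %/ N).+1 + N)) * (d ^ 2 + d + 1) * d ^ (D - 3).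
Proof.
move=> d1 D2 N0 se sf; have ke := squarefree_kautz sf; have D0 : 0 < D by lia.
set C := _ + _ * (_ + N).
pose S k := \sum_(i < k) #|ends x0 e k i|.
have SE k : k <= D -> k * d ^ k.-1 <= S k + C * d ^ k.-1.
  move=> kD; apply: leq_trans (leq_add (leqnn _) (sum_card_bad se sf N0 d1 kD)).
  have -> : k * d ^ k.-1 = \sum_(i < k) d ^ k.-1 by rewrite sum_nat_const card_ord.
  rewrite -big_split /=.
  by apply: leq_sum => i _; rewrite (card_ends x0 D0 se ke (ltn_ord i) kD).
have : \sum_(k < D.+1) S k <= cong (@kautz_arc d D) (arc_of_word x0 e).
  exact: sum_card_ends.
move: (cong _ _) => c; clearbody S C; clear -SE D2.
case: D => [|[|[|D]]] // in D2 SE *; rewrite !big_ord_recr /= => le.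
have := SE D.+3 (leqnn _); have := SE D.+2 (leqnSn _); have := SE D.+1 (leqW (leqnSn _)).
by rewrite /tau !subSS !subn0 /= !expnS expn0 => h1 h2 h3; lia.
Qed.

Theorem mainTheorem1 (d : nat) (hd : 2 <= d) :
  exists D0 : nat, forall D : nat, D0 <= D ->
    exists e : kautz d D * kautz d D,
      kautz_arc e.1 e.2 /\ tau d D < cong (@kautz_arc d D) e.
Proof.
(* With [N = 4 * q] the loss, divided by [d ^ (D - 3)], is at most (D + 1) / 2 + 16 q^2 + 2 q, which
   is below D - 2 from this threshold on. *)
set q := d ^ 2 + d + 1; exists (40 * q ^ 2 + 20) => D le.
have sf := @vtm_prefix_squarefree d D.+1 hd; set e := vtm_prefix d D.+1 in sf.
have se : size e = D.+1 by apply: size_mkseq.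
have ke := squarefree_kautz sf.
have st : size (take D e) == D by rewrite size_takel // se.
pose x0 : kautz d D := Kautz (kautz_val := Tuple st) (take_sorted D ke).
exists (arc_of_word x0 e); split; first by apply: arc_of_wordP => //; lia.
have q1 : 0 < q by rewrite /q addn1.
have H : _ <= _ := cong_tau_bound x0 hd (_ : 2 < D) (_ : 0 < 4 * q) se sf.
have small : (2 * (4 * q) + 2 * ((D.+1 %/ (4 * q)).+1 + 4 * q)) * q < D - 2.
  have := leq_divM D.+1 (4 * q); move: (_ %/ _) => r.
  by move: le q1; clear; rewrite -mulnn; nia.
have X0 : 0 < d ^ (D - 3) by rewrite expn_gt0 (ltnW hd).
rewrite -(ltn_add2r ((D - 2) * d ^ (D - 3))).
apply: leq_ltn_trans (H _ _) _; [lia|lia|].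
by rewrite ltn_add2l -/q ltn_pmul2r.
Qed.
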